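(* Let $p>0$ be a prime number and let $V$ be a valuation domain of mixed characteristic $p$. Assume that there is an element $\varpi \in V$ together with a unit $u \in V^\times$ such that $\varpi^p=pu$. Then the Frobenius endomorphism on $V/pV$ induces a faithfully flat map $V/\varpi V \to (V/pV)^{[F]}$; that is, the ring homomorphism $V/\varpi V \to V/pV$, $x \bmod \varpi \mapsto x^p \bmod p$, is faithfully flat.
   Context: Mixed characteristic $p$ means that the field of fractions of $V$ has characteristic $0$ and the residue field of $V$ has characteristic $p$. For a ring $A$ and an $A$-module $M$ with $pM=0$, $M^{[F]}$ denotes $M$ as an additive group, with module structure given by restriction of scalars along the Frobenius endomorphism of $A/pA$. Since $\varpi^p=pu$, the Frobenius endomorphism of $V/pV$ kills the ideal generated by $\varpi$ and so factors through $V/\varpi V$. *)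

(* Defs.v *)
From HB Require Import structures.
From mathcomp Require Import all_boot all_order all_algebra.
From mathcomp Require Import boolp.
From mathcomp Require Import freeg.

Set Implicit Arguments.
Unset Strict Implicit.
Unset Printing Implicit Defensive.

Import GRing.Theory.
Local Open Scope ring_scope.
Local Open Scope quotient_scope.

Definition principal (R : comPzRingType) (a : R) : {pred R} :=
  fun x => `[< exists y, x = y * a >].

Lemma principal_zmod_closed (R : comPzRingType) (a : R) :
  zmod_closed (principal a).
Proof.
split=> [|x y /asboolP[b ->] /asboolP[c ->]]; apply/asboolP.
  by exists 0; rewrite mul0r.
by exists (b - c); rewrite mulrBl.
Qed.

HB.instance Definition _ (R : comPzRingType) (a : R) :=
  GRing.isZmodClosed.Build R (principal a) (principal_zmod_closed a).

(* [{ideal_quot I}] only has a ring structure when I is a proper ideal; here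
   a may be a unit, in which case the quotient is the zero ring. *)
Definition principal_quot (R : comPzRingType) (a : R) : Type :=
  @Quotient.quot R (principal a).

Section PrincipalQuot.
Variables (R : comPzRingType) (a : R).
Local Notation Q := (principal_quot a).

HB.instance Definition _ := GRing.Zmodule.on Q.

Definition proj (x : R) : Q := \pi_(@Quotient.quot R (principal a)) x.

Fact proj_zmod_morphism : zmod_morphism proj.
Proof. by move=> x y; rewrite /proj raddfB. Qed.

HB.instance Definition _ :=
  GRing.isZmodMorphism.Build R Q proj proj_zmod_morphism.

Lemma proj_eqP (x y : R) : proj x = proj y <-> exists z, x - y = z * a.
Proof.
rewrite /proj; split=> [/eqP|h].
  by rewrite -Quotient.idealrBE => /asboolP.
by apply/eqP; rewrite -Quotient.idealrBE; apply/asboolP.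
Qed.

Definition rep (q : Q) : R := repr (q : @Quotient.quot R (principal a)).

Lemma repK : cancel rep proj.
Proof. by move=> q; rewrite /rep /proj reprK. Qed.

Definition quot_mul (q r : Q) : Q := proj (rep q * rep r).

Lemma proj_mul (x y : R) : quot_mul (proj x) (proj y) = proj (x * y).
Proof.
have [[b Hb] [c Hc]] := (proj1 (proj_eqP _ _) (repK (proj x)),
                         proj1 (proj_eqP _ _) (repK (proj y))).
apply/proj_eqP; exists (b * rep (proj y) + c * x).
rewrite mulrDl mulrAC -Hb mulrAC -Hc mulrBl mulrBl.
by rewrite [rep (proj y) * x]mulrC [y * x]mulrC addrA subrK.
Qed.

Fact quot_mulA : associative quot_mul.
Proof.
by move=> x y z; rewrite -[x]repK -[y]repK -[z]repK !proj_mul mulrA.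
Qed.

Fact quot_mulC : commutative quot_mul.
Proof. by move=> x y; rewrite -[x]repK -[y]repK !proj_mul mulrC. Qed.

Fact quot_mul1 : left_id (proj 1) quot_mul.
Proof. by move=> x; rewrite -[x]repK !proj_mul mul1r. Qed.

Fact quot_mulD : left_distributive quot_mul +%R.
Proof.
move=> x y z; rewrite -[x]repK -[y]repK -[z]repK.
by rewrite -raddfD !proj_mul mulrDl raddfD.
Qed.

HB.instance Definition _ := GRing.Zmodule_isComPzRing.Build Q
  quot_mulA quot_mulC quot_mul1 quot_mulD.

Fact proj_monoid_morphism : monoid_morphism proj.
Proof. by split=> // x y; rewrite -proj_mul. Qed.

HB.instance Definition _ :=
  GRing.isMonoidMorphism.Build R Q proj proj_monoid_morphism.

End PrincipalQuot.

HB.mixin Record isValuationDomain V of GRing.IntegralDomain V := {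
  dvd_total : forall a b : V, (exists c, b = c * a) \/ (exists c, a = c * b)
}.

#[short(type="valuationDomainType")]
HB.structure Definition ValuationDomain :=
  {V of isValuationDomain V & GRing.IntegralDomain V}.

Section ResidueField.
Variable V : valuationDomainType.

Definition maximal_ideal : {pred V} := fun x => x \isn't a GRing.unit.

Fact maximal_ideal_closed : idealr_closed maximal_ideal.
Proof.
have memE (x : V) : (x \in maximal_ideal) = (x \isn't a GRing.unit) by [].
have mulP (a x : V) : x \in maximal_ideal -> a * x \in maximal_ideal.
  by rewrite !memE unitrM negb_and => ->; rewrite orbT.
split; rewrite ?memE ?unitr0 ?unitr1 // => a x y xm ym.
have addP (s t c : V) : t = c * s -> s \in maximal_ideal ->
    s + t \in maximal_ideal.
  by move=> -> sm; rewrite -{1}[s]mul1r -mulrDl; apply: mulP.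
have axm := mulP a x xm.
have [[c e]|[c e]] := dvd_total (a * x) y; first exact: addP e axm.
by rewrite addrC; apply: addP e ym.
Qed.

HB.instance Definition _ := isIdealr.Build V maximal_ideal maximal_ideal_closed.

Definition residue_field : Type := {ideal_quot maximal_ideal}.
HB.instance Definition _ := GRing.ComNzRing.on residue_field.

Definition mixed_characteristic (p : nat) : Prop :=
  [pchar {fraction V}] =i pred0 /\ p \in [pchar residue_field].

End ResidueField.

Section Tensor.
Variables (A : comPzRingType) (N M : lmodType A).

Inductive tensor_rel : {freeg (N * M)%type} -> Prop :=
| tensor_rel0 : tensor_rel 0
| tensor_relB s t : tensor_rel s -> tensor_rel t -> tensor_rel (s - t)
| tensor_relDl n n' m :
    tensor_rel (<< (n + n', m) >> - << (n, m) >> - << (n', m) >>)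
| tensor_relDr n m m' :
    tensor_rel (<< (n, m + m') >> - << (n, m) >> - << (n, m') >>)
| tensor_relZ a n m :
    tensor_rel (<< (a *: n, m) >> - << (n, a *: m) >>).

Definition tensor_relb : {pred {freeg (N * M)%type}} := fun s => `[< tensor_rel s >].

Fact tensor_relb_closed : zmod_closed tensor_relb.
Proof.
split=> [|s t /asboolP hs /asboolP ht]; apply/asboolP.
  exact: tensor_rel0.
exact: tensor_relB.
Qed.

HB.instance Definition _ :=
  GRing.isZmodClosed.Build {freeg (N * M)%type} tensor_relb tensor_relb_closed.

(* Only the underlying abelian group of the tensor product over A is built:
   exactness does not depend on the A-module structure. *)
Definition tensor : Type := Quotient.quot tensor_relb.
HB.instance Definition _ := GRing.Zmodule.on tensor.

Definition tensor_proj (s : {freeg (N * M)%type}) : tensor :=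
  \pi_(Quotient.quot tensor_relb) s.

Fact tensor_proj_zmod_morphism : zmod_morphism tensor_proj.
Proof. by move=> x y; rewrite /tensor_proj raddfB. Qed.

HB.instance Definition _ := GRing.isZmodMorphism.Build
  {freeg (N * M)%type} tensor tensor_proj tensor_proj_zmod_morphism.

Definition tensor_rep (t : tensor) : {freeg (N * M)%type} :=
  repr (t : Quotient.quot tensor_relb).

Lemma tensor_repK : cancel tensor_rep tensor_proj.
Proof. by move=> t; rewrite /tensor_rep /tensor_proj reprK. Qed.

Lemma tensor_proj_eqP s t : tensor_proj s = tensor_proj t <-> tensor_rel (s - t).
Proof.
rewrite /tensor_proj; split=> [/eqP|h].
  by rewrite -Quotient.idealrBE => /asboolP.
by apply/eqP; rewrite -Quotient.idealrBE; apply/asboolP.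
Qed.

Definition pure_tensor (n : N) (m : M) : tensor := tensor_proj << (n, m) >>.

End Tensor.

Section TensorMap.
Variables (A : comPzRingType) (N N' M : lmodType A) (f : {linear N -> N'}).

Definition free_map (s : {freeg (N * M)%type}) : {freeg (N' * M)%type} :=
  fglift (fun z : N * M => << (f z.1, z.2) >>) s.

Fact free_map_zmod_morphism : zmod_morphism free_map.
Proof. exact: lift_is_additive. Qed.

HB.instance Definition _ := GRing.isZmodMorphism.Build
  {freeg (N * M)%type} {freeg (N' * M)%type} free_map free_map_zmod_morphism.

Lemma free_mapU n m : free_map << (n, m) >> = << (f n, m) >>.
Proof. by rewrite /free_map liftU scale1r. Qed.

Lemma free_map_rel s : tensor_rel s -> tensor_rel (free_map s).
Proof.
elim=> [|{}s t _ hs _ ht|n n' m|n m m'|a n m].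
- by rewrite raddf0; apply: tensor_rel0.
- by rewrite raddfB; apply: tensor_relB.
- by rewrite !raddfB /= !free_mapU raddfD; apply: tensor_relDl.
- by rewrite !raddfB /= !free_mapU; apply: tensor_relDr.
- by rewrite raddfB /= !free_mapU linearZ; apply: tensor_relZ.
Qed.

(* f tensored with the identity of M *)
Definition tensor_map (t : tensor N M) : tensor N' M :=
  tensor_proj (free_map (tensor_rep t)).

Lemma tensor_map_proj s : tensor_map (tensor_proj s) = tensor_proj (free_map s).
Proof.
apply/tensor_proj_eqP; rewrite -raddfB; apply: free_map_rel.
by apply/tensor_proj_eqP; rewrite tensor_repK.
Qed.

Lemma tensor_map_pure n m :
  tensor_map (pure_tensor n m) = pure_tensor (f n) m.
Proof. by rewrite tensor_map_proj free_mapU. Qed.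

Fact tensor_map_zmod_morphism : zmod_morphism tensor_map.
Proof.
move=> s t; rewrite -[s]tensor_repK -[t]tensor_repK -raddfB !tensor_map_proj.
by rewrite !raddfB.
Qed.

HB.instance Definition _ := GRing.isZmodMorphism.Build
  (tensor N M) (tensor N' M) tensor_map tensor_map_zmod_morphism.

End TensorMap.

Definition exact_at (X Y Z : zmodType) (f : X -> Y) (g : Y -> Z) : Prop :=
  forall y, g y = 0 <-> exists x, f x = y.

Definition faithfully_flat (A : comPzRingType) (M : lmodType A) : Prop :=
  forall (N1 N2 N3 : lmodType A) (f : {linear N1 -> N2}) (g : {linear N2 -> N3}),
    exact_at f g <-> exact_at (@tensor_map A N1 N2 M f) (@tensor_map A N2 N3 M g).

Definition restrict_scalars (A B : comPzRingType) (phi : {rmorphism A -> B})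
  (M : lmodType B) : Type := M.

Section RestrictScalars.
Variables (A B : comPzRingType) (phi : {rmorphism A -> B}) (M : lmodType B).
Local Notation phiM := (restrict_scalars phi M).

HB.instance Definition _ := GRing.Zmodule.on phiM.

Definition restrict_scale (a : A) (m : phiM) : phiM := phi a *: (m : M).

Fact restrict_scaleA a b m :
  restrict_scale a (restrict_scale b m) = restrict_scale (a * b) m.
Proof. by rewrite /restrict_scale scalerA rmorphM. Qed.

Fact restrict_scale1 : left_id 1 restrict_scale.
Proof. by move=> m; rewrite /restrict_scale rmorph1 scale1r. Qed.

Fact restrict_scaleDr : right_distributive restrict_scale +%R.
Proof. by move=> a m n; rewrite /restrict_scale scalerDr. Qed.

Fact restrict_scaleDl m : {morph restrict_scale^~ m : a b / a + b}.
Proof. by move=> a b; rewrite /restrict_scale rmorphD scalerDl. Qed.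

HB.instance Definition _ := GRing.Zmodule_isLmodule.Build A phiM
  restrict_scaleA restrict_scale1 restrict_scaleDr restrict_scaleDl.

End RestrictScalars.

Definition faithfully_flat_morphism (A B : comPzRingType)
    (phi : {rmorphism A -> B}) : Prop :=
  faithfully_flat (restrict_scalars phi B^o).

(* Main.v *)
Require Import Defs.
From mathcomp Require Import freeg.
From HB Require Import structures.
From mathcomp Require boolp.
From mathcomp Require Import all_boot all_order all_algebra.

Set Implicit Arguments.
Unset Strict Implicit.
Unset Printing Implicit Defensive.

Import GRing.Theory.
Local Open Scope ring_scope.

(** Write A = V/w and B = V/p, with B regarded as an A-module M through
x |-> x^p.

Divisibility in A is total, so every finitely generated ideal of A is principal
and flatness of M only has to be tested on relations a m = 0 of length one: M is
flat as soon as such a relation forces m into Ann(a) M.  For a the class of x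
and m the class of y, a m = 0 says that p divides x^p y.  Either w
divides x and a = 0, or w = c x, whence x^p c^p = p u; cancelling x^p shows that
c^p divides y, i.e. m is a multiple of the class of c, and that class
annihilates a ([frobenius_torsion], [equationally_flat_torsion]).  Faithfulness
comes from locality: a combination sum_j x_j^p z_j congruent to 1 modulo p must
involve a unit x_j, so 1 in M lies in I M only when the ideal I is the whole of
A ([frobenius_unimodular]).

The passage from these two properties to exactness of tensor sequences is
carried out on coefficients, with no submodules, quotients or localizations.
Call a family y in M together with a choice of coefficients c(m) expressing
elements m over y a coefficient system.  It lets one contract a formal sum
s = sum_i (n_i, m_i) to the vector with coordinates sum_i c_j(m_i) n_i in N, and
the tensor represented by s is recovered from this vector
([tensor_proj_contract]).  Flatness, read as the equational criterion, says that
a relation satisfied by y already holds among coefficients after y is expressed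
over another family.  Hence if s represents the zero tensor, the system can be
refined until the contraction itself vanishes ([tensor_rel_contract]).
Contraction commutes with linear maps, so exactness in N can be applied
coordinate by coordinate; when a coefficient system expresses a unimodular
element of M, its coefficients generate the unit ideal, which makes it possible
to descend from tensors back to N ([unimodular_descent]). *)

(** * Linear combinations in a module *)

Section LinearCombination.
Variables (A : comPzRingType) (M : lmodType A).

Definition lincomb k (r : 'rV[A]_k) (y : 'I_k -> M) : M :=
  \sum_j r 0 j *: y j.

Lemma lincombB k (r s : 'rV[A]_k) y :
  lincomb (r - s) y = lincomb r y - lincomb s y.
Proof.
rewrite /lincomb -sumrB; apply: eq_bigr => j _.
by rewrite !mxE scalerBl.
Qed.

Lemma lincombZ k a (r : 'rV[A]_k) y : lincomb (a *: r) y = a *: lincomb r y.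
Proof.
by rewrite /lincomb scaler_sumr; apply: eq_bigr => j _; rewrite mxE scalerA.
Qed.

Lemma lincomb_delta k (j : 'I_k) y : lincomb (delta_mx 0 j) y = y j.
Proof.
rewrite /lincomb (bigD1 j) //= mxE !eqxx scale1r big1 ?addr0 // => i ij.
by rewrite mxE (negbTE ij) andbF scale0r.
Qed.

Lemma lincomb_mulmx k l (r : 'rV[A]_k) (X : 'M_(k, l)) y z :
  (forall j, y j = lincomb (row j X) z) -> lincomb r y = lincomb (r *m X) z.
Proof.
move=> yE; rewrite /lincomb.
under eq_bigr => j _ do rewrite yE /lincomb scaler_sumr.
rewrite exchange_big; apply: eq_bigr => i _ /=.
rewrite mxE scaler_suml; apply: eq_bigr => j _.
by rewrite mxE scalerA.
Qed.

(** The equational criterion for flatness: every relation among elements of M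
comes from relations among coefficients in A. *)
Definition equationally_flat : Prop :=
  forall k (r : 'rV[A]_k) (y : 'I_k -> M), lincomb r y = 0 ->
  exists l (X : 'M_(k, l)) (z : 'I_l -> M),
    (forall j, y j = lincomb (row j X) z) /\ r *m X = 0.

(** Equivalently, m belongs to I M for no proper ideal I of A; the column s
witnesses that the coefficients r generate the unit ideal. *)
Definition unimodular_element (m : M) : Prop :=
  forall k (r : 'rV[A]_k) (y : 'I_k -> M), lincomb r y = m ->
  exists s : 'cV[A]_k, r *m s = 1%:M.

(** Coefficients are given by a function on all of M, constrained only on the
finite list F, so that enlarging F never changes the type of c. *)
Definition coefficients_on k (F : seq M) (c : M -> 'rV[A]_k) y : Prop :=
  {in F, forall m, lincomb (c m) y = m}.

Lemma exists_coefficients (F : seq M) :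
  exists k (c : M -> 'rV[A]_k) y, coefficients_on F c y.
Proof.
exists (size F), (fun m => \row_(j < size F) ((j : nat) == index m F)%:R).
exists (fun j => nth 0 F j) => m mF.
have iF : (index m F < size F)%N by rewrite index_mem.
suff -> : \row_(j < size F) ((j : nat) == index m F)%:R =
          delta_mx 0 (Ordinal iF) :> 'rV[A]__.
  by rewrite lincomb_delta nth_index.
by apply/rowP => j; rewrite !mxE eqxx.
Qed.

Lemma coefficients_on_mulmx k l F (c : M -> 'rV[A]_k) (X : 'M_(k, l)) y z :
    (forall j, y j = lincomb (row j X) z) ->
  coefficients_on F c y -> coefficients_on F (fun m => c m *m X) z.
Proof. by move=> yE cF m mF; rewrite -(lincomb_mulmx _ yE) cF. Qed.

Lemma coefficients_on_sub k (F G : seq M) (c : M -> 'rV[A]_k) y :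
  {subset F <= G} -> coefficients_on G c y -> coefficients_on F c y.
Proof. by move=> FG cG m /FG /cG. Qed.

End LinearCombination.

(** * Vanishing in a tensor product *)

Lemma freeg_morphism_ext (K : choiceType) (Z : zmodType) (s : {freeg K})
    (f g : {freeg K} -> Z) :
    zmod_morphism f -> zmod_morphism g ->
  {in dom s, forall x, f << x >> = g << x >>} -> f s = g s.
Proof.
move=> fB gB fg.
pose f' : {additive {freeg K} -> Z} :=
  HB.pack f (GRing.isZmodMorphism.Build _ _ f fB).
pose g' : {additive {freeg K} -> Z} :=
  HB.pack g (GRing.isZmodMorphism.Build _ _ g gB).
rewrite -[f s]/(f' s) -[g s]/(g' s) -[s]freeg_sumE !raddf_sum.
apply: eq_big_seq => x xs.
rewrite -[coeff x s]intz -freegU_mulz !raddfMz.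
by congr (_ *~ _); apply: fg.
Qed.

Section Contract.
Variables (A : comPzRingType) (N M : lmodType A).

(** For linear a this is the map induced by 1 (x) a on the tensor product; for
other functions a it only makes sense on formal sums.  The alias zmodule gives
N the integer-module structure needed to extend from generators. *)
Definition contract (a : M -> A) (s : {freeg (N * M)%type}) : N :=
  fglift (fun x : N * M => (a x.2 *: x.1 : zmodule N)) s.

Fact contract_zmod_morphism a : zmod_morphism (contract a).
Proof. exact: (lift_is_additive (M := zmodule N)). Qed.

HB.instance Definition _ a := GRing.isZmodMorphism.Build
  {freeg (N * M)%type} N (contract a) (contract_zmod_morphism a).

Lemma contractU a n m : contract a << (n, m) >> = a m *: n.
Proof. by rewrite /contract liftU scale1r. Qed.

Lemma contract_mulmx k l (c : M -> 'rV[A]_k) (X : 'M_(k, l)) i s :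
  contract (fun m => (c m *m X) 0 i) s =
  \sum_j X j i *: contract (fun m => c m 0 j) s.
Proof.
apply: (freeg_morphism_ext (g := fun s =>
  \sum_j X j i *: contract (fun m => c m 0 j) s)) => [|t t'|[n m] _].
- exact: contract_zmod_morphism.
- by rewrite -sumrB; apply: eq_bigr => j _; rewrite raddfB scalerBr.
rewrite contractU mxE scaler_suml; apply: eq_bigr => j _.
by rewrite contractU scalerA mulrC.
Qed.

Lemma tensor_proj_eq0 (s : {freeg (N * M)%type}) :
  tensor_proj s = 0 <-> tensor_rel s.
Proof. by rewrite -(raddf0 (@tensor_proj A N M)) tensor_proj_eqP subr0. Qed.

Lemma pure_tensorBl (n n' : N) (m : M) :
  pure_tensor (n - n') m = pure_tensor n m - pure_tensor n' m.
Proof.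
have /tensor_proj_eq0 := tensor_relDl (n - n') n' m.
rewrite subrK !raddfB => /eqP; rewrite -addrA -opprD subr_eq0 => /eqP e.
by rewrite [X in _ = X - _]e addrK.
Qed.

Lemma pure_tensor0l (m : M) : pure_tensor (0 : N) m = 0.
Proof. by rewrite -[X in pure_tensor X](subrr (0 : N)) pure_tensorBl subrr. Qed.

Lemma pure_tensorBr (n : N) (m m' : M) :
  pure_tensor n (m - m') = pure_tensor n m - pure_tensor n m'.
Proof.
have /tensor_proj_eq0 := tensor_relDr n (m - m') m'.
rewrite subrK !raddfB => /eqP; rewrite -addrA -opprD subr_eq0 => /eqP e.
by rewrite [X in _ = X - _]e addrK.
Qed.

Lemma pure_tensorZ a (n : N) (m : M) :
  pure_tensor (a *: n) m = pure_tensor n (a *: m).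
Proof. by apply/tensor_proj_eqP; apply: tensor_relZ. Qed.

Lemma pure_tensor_sumr (n : N) k (y : 'I_k -> M) :
  pure_tensor n (\sum_j y j) = \sum_j pure_tensor n (y j).
Proof.
pose h : {additive M -> tensor N M} := HB.pack (@pure_tensor A N M n)
  (GRing.isZmodMorphism.Build _ _ (@pure_tensor A N M n) (pure_tensorBr n)).
exact: (raddf_sum h).
Qed.

(** Expressing every second component over y and moving the coefficients across
the tensor sign collects the tensor of s along y. *)
Lemma tensor_proj_contract k (c : M -> 'rV[A]_k) y s :
    coefficients_on [seq x.2 | x <- dom s] c y ->
  tensor_proj s = \sum_j pure_tensor (contract (fun m => c m 0 j) s) (y j).
Proof.
move=> cs; apply: (freeg_morphism_ext (g := fun s =>
  \sum_j pure_tensor (contract (fun m => c m 0 j) s) (y j)))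
  => [|t t'|[n m] xs].
- exact: tensor_proj_zmod_morphism.
- by rewrite -sumrB; apply: eq_bigr => j _; rewrite raddfB pure_tensorBl.
rewrite -[LHS]/(pure_tensor n m) -{1}[m]cs ?(map_f _ xs) //.
rewrite pure_tensor_sumr; apply: eq_bigr => j _.
by rewrite contractU pure_tensorZ.
Qed.

(** The finite list F collects the elements of M used by a derivation of the
relation s.  Quantifying over all coefficient systems on F makes the induction
go through for differences: a system refined for s can be refined again for t,
and a contraction that vanishes keeps vanishing under refinement.  Relations
that are additive in N contract to zero at once; each of the other two contracts
to the multiples r_j n, with r a relation among the y_j, and flatness provides a
refinement in which r becomes zero. *)
Lemma tensor_rel_refine (s : {freeg (N * M)%type}) :
    equationally_flat M -> tensor_rel s ->
  exists F : seq M, forall k (c : M -> 'rV[A]_k) y, coefficients_on F c y ->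
  exists l (X : 'M_(k, l)) (z : 'I_l -> M),
    (forall j, y j = lincomb (row j X) z) /\
    (forall i, contract (fun m => (c m *m X) 0 i) s = 0).
Proof.
move=> flatM.
have id_refine k (y : 'I_k -> M) j : y j = lincomb (row j 1%:M) y.
  by rewrite row1 lincomb_delta.
elim=> [|{}s t _ [F Fs] _ [G Gt]|n n' m|n m m'|a n m].
- exists [::] => k c y _; exists k, 1%:M, y; split=> // i.
  by rewrite raddf0.
- exists (F ++ G) => k c y cFG.
  have [|l [X [z [yz sX]]]] := Fs _ c y.
    by apply: coefficients_on_sub cFG => x xF; rewrite mem_cat xF.
  have [|l' [X' [z' [zz' tX']]]] := Gt _ (fun m => c m *m X) z.
    apply: (coefficients_on_mulmx yz); apply: coefficients_on_sub cFG => x xG.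
    by rewrite mem_cat xG orbT.
  exists l', (X *m X'), z'; split=> [j|i].
    by rewrite row_mul -(lincomb_mulmx _ zz') -yz.
  transitivity (contract (fun m => (c m *m X *m X') 0 i) (s - t)).
    by congr (contract _ _); apply: boolp.funext => x; rewrite mulmxA.
  rewrite raddfB /= tX' subr0 contract_mulmx big1 // => j _.
  by rewrite sX scaler0.
- exists [::] => k c y _; exists k, 1%:M, y; split=> // i.
  by rewrite !raddfB /= !contractU scalerDr addrAC addrK subrr.
- exists [:: m + m'; m; m'] => k c y cF.
  pose r := c (m + m') - c m - c m'.
  have [|l [X [z [yz rX]]]] := flatM _ r y.
    by rewrite !lincombB !cF ?inE ?eqxx ?orbT // addrAC addrK subrr.
  exists l, X, z; split=> // i.
  rewrite !raddfB /= !contractU -!scalerBl.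
  have -> : (c (m + m') *m X) 0 i - (c m *m X) 0 i - (c m' *m X) 0 i =
            (r *m X) 0 i by rewrite !mulmxBl !mxE.
  by rewrite rX mxE scale0r.
exists [:: a *: m; m] => k c y cF.
pose r := a *: c m - c (a *: m).
have [|l [X [z [yz rX]]]] := flatM _ r y.
  by rewrite lincombB lincombZ !cF ?inE ?eqxx ?orbT // subrr.
exists l, X, z; split=> // i.
rewrite raddfB /= !contractU scalerA -scalerBl.
have -> : (c m *m X) 0 i * a - (c (a *: m) *m X) 0 i = (r *m X) 0 i.
  by rewrite mulmxBl -scalemxAl !mxE mulrC.
by rewrite rX mxE scale0r.
Qed.

(** The system has to express more than what the derivation of s involves: G
holds the elements occurring in a formal sum mapped to s, or a unimodular
element. *)
Lemma tensor_rel_contract (s : {freeg (N * M)%type}) (G : seq M) :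
    equationally_flat M -> tensor_rel s ->
  exists k (c : M -> 'rV[A]_k) y, coefficients_on G c y /\
    forall i, contract (fun m => c m 0 i) s = 0.
Proof.
move=> flatM /(tensor_rel_refine flatM)[F Fs].
have [k [c [y cFG]]] := exists_coefficients (F ++ G).
have [|l [X [z [yz sX]]]] := Fs _ c y.
  by apply: coefficients_on_sub cFG => x xF; rewrite mem_cat xF.
exists l, (fun m => c m *m X), z; split=> //.
apply: (coefficients_on_mulmx yz); apply: coefficients_on_sub cFG => x xG.
by rewrite mem_cat xG orbT.
Qed.

End Contract.

Lemma contract_free_map (A : comPzRingType) (N N' M : lmodType A)
    (f : {linear N -> N'}) (a : M -> A) s :
  contract a (free_map f s) = f (contract a s).
Proof.
apply: (freeg_morphism_ext (f := fun s => contract a (free_map f s))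
  (g := fun s => f (contract a s))) => [t t'|t t'|[n m] _].
- by rewrite !raddfB.
- by rewrite !raddfB.
by rewrite /= free_mapU !contractU linearZ.
Qed.

(** * A criterion for faithful flatness *)

Section FaithfullyFlat.
Variables (A : comPzRingType) (M : lmodType A).
Hypothesis flatM : equationally_flat M.

(** Contracting a representative of t along a system that kills its image under
g puts every coordinate in the kernel of g, hence in the image of f. *)
Lemma equationally_flat_exact (N1 N2 N3 : lmodType A)
    (f : {linear N1 -> N2}) (g : {linear N2 -> N3}) :
  exact_at f g -> exact_at (tensor_map (M := M) f) (tensor_map (M := M) g).
Proof.
move=> fg t; split=> [|[{}t <-]].
  rewrite -[t]tensor_repK; set s := tensor_rep t.
  rewrite tensor_map_proj => /tensor_proj_eq0 gs.
  have [k [c [y [cs gs0]]]] :=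
    tensor_rel_contract [seq x.2 | x <- dom s] flatM gs.
  have /fin_all_exists[x xE] i :
      exists x, f x = contract (fun m => c m 0 i) s.
    by apply/fg; rewrite -contract_free_map.
  exists (\sum_i pure_tensor (x i) (y i)).
  rewrite raddf_sum (tensor_proj_contract cs); apply: eq_bigr => i _ /=.
  by rewrite tensor_map_pure xE.
rewrite -[t]tensor_repK !tensor_map_proj.
apply: (freeg_morphism_ext
  (f := fun s => tensor_proj (free_map g (free_map f s))) (g := fun=> 0)).
- by move=> s s'; rewrite !raddfB.
- by move=> s s'; rewrite subr0.
move=> [n m] _; rewrite !free_mapU /=.
have -> : g (f n) = 0 by apply/fg; exists n.
exact: pure_tensor0l.
Qed.

Variable m0 : M.
Hypothesis m0_unimodular : unimodular_element m0.

(** Contracting the relation (n, m0) - f s coordinatewise gives that c_j(m0) n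
lies in the image of f for every j, and the c_j(m0) generate the unit ideal. *)
Lemma unimodular_descent (N1 N2 : lmodType A) (f : {linear N1 -> N2}) n t :
  tensor_map f t = pure_tensor n m0 -> exists x, f x = n.
Proof.
rewrite -[t]tensor_repK; set s := tensor_rep t.
rewrite tensor_map_proj => /tensor_proj_eqP fsn.
have [k [c [y [cm0 fsn0]]]] := tensor_rel_contract [:: m0] flatM fsn.
have [|v /matrixP/(_ 0 0) cv] := m0_unimodular (r := c m0) (y := y).
  by rewrite cm0 ?inE.
exists (\sum_i v i 0 *: contract (fun m => c m 0 i) s).
rewrite raddf_sum -[RHS]scale1r.
have -> : 1 = \sum_j c m0 0 j * v j 0 by move: cv; rewrite !mxE.
rewrite scaler_suml; apply: eq_bigr => i _ /=.
rewrite linearZ /= -contract_free_map mulrC -scalerA; congr (_ *: _).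
have /eqP := fsn0 i.
by rewrite raddfB /= contractU subr_eq0 => /eqP.
Qed.

Lemma equationally_flat_faithful : faithfully_flat M.
Proof.
move=> N1 N2 N3 f g; split; first exact: equationally_flat_exact.
move=> fgM n; split=> [gn|[x <-]].
  have [t ft] : exists t, tensor_map f t = pure_tensor n m0.
    by apply/fgM; rewrite tensor_map_pure gn pure_tensor0l.
  exact: unimodular_descent ft.
have gfx : tensor_map g (tensor_map f (pure_tensor x m0)) = 0.
  by apply/fgM; exists (pure_tensor x m0).
(* Descent along the zero map says that g (f x) is 0. *)
pose z : {linear N1 -> N3} := \0.
have [|y <-] := @unimodular_descent _ _ z (g (f x)) 0; last by [].
by rewrite raddf0 -!tensor_map_pure.
Qed.

End FaithfullyFlat.

(** * Flatness over a ring whose divisibility is total *)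

Section DivisibilityTotal.
Variable A : comPzRingType.
Hypothesis dvdA :
  forall a b : A, (exists c, b = c * a) \/ (exists c, a = c * b).

Lemma exists_common_divisor k (r : 'rV[A]_k.+1) :
  exists j0, exists d : 'rV[A]_k.+1, r = r 0 j0 *: d /\ d 0 j0 = 1.
Proof.
suff [j0 /fin_all_exists[d dE]] :
    exists j0, forall j, exists d, r 0 j = d * r 0 j0.
  exists j0, (\row_j if j == j0 then 1 else d j).
  split; last by rewrite mxE eqxx.
  apply/rowP => j; rewrite !mxE.
  by case: eqP => [->|_]; rewrite ?mulr1 // dE mulrC.
elim: k r => [|k IH] r.
  by exists 0 => j; exists 1; rewrite mul1r !ord1.
have [j0 j0P] := IH (\row_j r 0 (lift ord0 j)).
have {}j0P j : exists d, r 0 (lift ord0 j) = d * r 0 (lift ord0 j0).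
  by have [d] := j0P j; rewrite !mxE; exists d.
have [[c cE]|[c cE]] := dvdA (r 0 ord0) (r 0 (lift ord0 j0)).
  exists ord0 => j; have [j' ->|->] := unliftP ord0 j.
    by have [d ->] := j0P j'; exists (d * c); rewrite cE mulrA.
  by exists 1; rewrite mul1r.
exists (lift ord0 j0) => j; have [j' ->|->] := unliftP ord0 j.
  exact: j0P.
by exists c.
Qed.

(** A relation r y = 0 reads r_j0 (d y) = 0 with r_j0 the common divisor, so the
torsion hypothesis gives d y = b m with r_j0 b = 0.  As d_j0 = 1, this
expresses y_j0 over the family obtained from y by putting m in place of y_j0. *)
Lemma equationally_flat_torsion (M : lmodType A) :
    (forall a (m : M), a *: m = 0 ->
       exists b m', a * b = 0 /\ m = b *: m') ->
  equationally_flat M.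
Proof.
move=> torsM [|k] r y ry.
  exists 0, 0, y; split=> [[]//|].
  by apply/rowP => -[].
have [j0 [d [rE d1]]] := exists_common_divisor r.
have [|b [m [rb dy]]] := torsM (r 0 j0) (lincomb d y).
  by rewrite -lincombZ -rE.
(* Row j0 says y_j0 = b m - sum_(i != j0) d_i y_i; the other rows say
   y_j = y_j. *)
pose X := \matrix_(j, i) if i == j0 then (if j == j0 then b else 0)
  else if j == j0 then - d 0 i else (j == i)%:R.
exists k.+1, X, (fun i => if i == j0 then m else y i); split=> [j|].
  rewrite /lincomb (bigD1 j0) //= !mxE eqxx.
  under eq_bigr => i /negbTE ij0 do rewrite !mxE ij0.
  have [->|jj0] := eqVneq j j0.
    under eq_bigr do rewrite scaleNr.
    by rewrite -dy /lincomb (bigD1 j0) //= d1 scale1r sumrN addrK.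
  rewrite scale0r add0r (bigD1 j) //= eqxx scale1r big1 ?addr0 // => i.
  by move=> /andP[_ /negbTE ij]; rewrite eq_sym ij scale0r.
apply/rowP => i; rewrite !mxE (bigD1 j0) //= !mxE eqxx.
have [->|ij0] := eqVneq i j0.
  rewrite rb add0r big1 // => j /negbTE jj0.
  by rewrite !mxE eqxx jj0 mulr0.
rewrite (bigD1 i) //= !mxE (negbTE ij0) eqxx mulr1 big1 => [|j].
  by rewrite addr0 {2}rE mxE mulrN addrC subrr.
by move=> /andP[/negbTE jj0 /negbTE ji]; rewrite !mxE (negbTE ij0) jj0 ji mulr0.
Qed.

End DivisibilityTotal.

(** * The Frobenius map of a valuation ring modulo p *)

(** Stated for rings that may be zero, as V/p is when p is a unit; the notion of
characteristic, and with it the Frobenius endomorphism, presupposes 1 != 0. *)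
Lemma exprD_prime (R : comPzSemiRingType) (p : nat) (x y : R) :
  prime p -> p%:R = 0 :> R -> (x + y) ^+ p = x ^+ p + y ^+ p.
Proof.
move=> p_prime p0; have defp := prednK (prime_gt0 p_prime).
rewrite exprDn big_ord_recr subnn -defp big_ord_recl /= defp.
rewrite subn0 mulr1 mul1r bin0 binn big1 ?addr0 // => i _.
have /dvdnP[q ->] : (p %| 'C(p, bump 0 i))%N.
  by rewrite prime_dvd_bin //= -{2}defp ltnS (valP i).
by rewrite -mulr_natl natrM p0 mulr0 mul0r.
Qed.

Lemma proj_eq0 (R : comPzRingType) (a x : R) :
  proj a x = 0 <-> exists y, x = y * a.
Proof. by rewrite -(raddf0 (proj a)) proj_eqP subr0. Qed.

Lemma proj_surj (R : comPzRingType) (a : R) (q : principal_quot a) :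
  exists x, q = proj a x.
Proof. by exists (rep q); rewrite repK. Qed.

Lemma quot_natr_eq0 (R : comPzRingType) (n : nat) :
  n%:R = 0 :> principal_quot (n%:R : R).
Proof.
by rewrite -(rmorph_nat (proj _)); apply/proj_eq0; exists 1; rewrite mul1r.
Qed.

Lemma quot_dvd_total (V : valuationDomainType) (w : V)
    (a b : principal_quot w) :
  (exists c, b = c * a) \/ (exists c, a = c * b).
Proof.
have [[x ->] [y ->]] := (proj_surj a, proj_surj b).
by have [[c ->]|[c ->]] := dvd_total x y; [left|right];
  exists (proj w c); rewrite rmorphM.
Qed.

Section Frobenius.
Variables (p : nat) (p_prime : prime p) (V : valuationDomainType).
Variables (w u : V) (u_unit : u \is a GRing.unit) (wpE : w ^+ p = p%:R * u).

Local Notation A := (principal_quot w).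
Local Notation B := (principal_quot (p%:R : V)).

Definition frobenius (q : A) : B := proj p%:R (rep q ^+ p).

(** Independence of the representative: x + z w has p-th power x^p modulo p,
since w^p is a multiple of p. *)
Lemma frobenius_proj x : frobenius (proj w x) = proj p%:R (x ^+ p).
Proof.
have /proj_eqP[z xz] := repK (proj w x); rewrite /frobenius.
rewrite -[rep _](subrK x) xz rmorphXn rmorphD /=.
rewrite (exprD_prime _ _ p_prime (quot_natr_eq0 V p)).
rewrite -!rmorphXn /= (_ : proj _ ((z * w) ^+ p) = 0) ?add0r //.
by apply/proj_eq0; exists (z ^+ p * u); rewrite exprMn wpE mulrCA mulrC.
Qed.

Fact frobenius_zmod_morphism : zmod_morphism frobenius.
Proof.
move=> a b; have [[x ->] [y ->]] := (proj_surj a, proj_surj b).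
rewrite -rmorphB !frobenius_proj; apply/eqP; rewrite eq_sym subr_eq; apply/eqP.
rewrite !rmorphXn /= -(exprD_prime _ _ p_prime (quot_natr_eq0 V p)).
by rewrite -rmorphD subrK.
Qed.

Fact frobenius_monoid_morphism : monoid_morphism frobenius.
Proof.
split=> [|a b].
  by rewrite -(rmorph1 (proj w)) frobenius_proj expr1n rmorph1.
have [[x ->] [y ->]] := (proj_surj a, proj_surj b).
by rewrite -rmorphM !frobenius_proj exprMn rmorphM.
Qed.

HB.instance Definition _ :=
  GRing.isZmodMorphism.Build A B frobenius frobenius_zmod_morphism.
HB.instance Definition _ :=
  GRing.isMonoidMorphism.Build A B frobenius frobenius_monoid_morphism.

Definition frobenius_rmorphism : {rmorphism A -> B} := frobenius.

Local Notation FB := (restrict_scalars frobenius_rmorphism B^o).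

(** If w does not divide x then w = c x, and p u = c^p x^p turns x^p y = z p
into y = c^p z / u, where the class of c annihilates the class of x. *)
Lemma frobenius_torsion (p_neq0 : p%:R != 0 :> V) (a : A) (m : FB) :
  a *: m = 0 -> exists b (m' : FB), a * b = 0 /\ m = b *: m'.
Proof.
have [[x ->] [y my]] := (proj_surj a, proj_surj (m : B)).
rewrite {m}my => am.
have {am} : proj p%:R (x ^+ p * y) = 0.
  by rewrite rmorphM /= -frobenius_proj; exact: am.
case/proj_eq0=> z xyz.
have [[c wE]|[c xE]] := dvd_total x w; last first.
  exists 1, (proj p%:R y); rewrite scale1r mulr1; split=> //.
  by apply/proj_eq0; exists c.
exists (proj w c), (proj p%:R (u^-1 * z)); split.
  by rewrite -rmorphM; apply/proj_eq0; exists 1; rewrite wE mulrC mul1r.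
rewrite -[RHS]/(frobenius _ * proj _ _) frobenius_proj -rmorphM.
congr proj; apply: (mulfI (x := x ^+ p)).
  have u_neq0 := memPn (negbT (unitr0 V)) _ u_unit.
  apply: contraNneq (mulf_neq0 p_neq0 u_neq0) => x0.
  by rewrite -wpE wE exprMn x0 mulr0.
have cx : x ^+ p * c ^+ p = p%:R * u by rewrite -wpE wE exprMn mulrC.
by rewrite xyz mulrA cx mulrA mulrK // mulrC.
Qed.

(** If the coefficients r_j lifted to nonunits x_j only, the congruence
1 = sum_j x_j^p z_j modulo p would put 1 in the maximal ideal. *)
Lemma frobenius_unimodular :
  (p%:R : V) \isn't a GRing.unit -> unimodular_element (1 : FB).
Proof.
move=> pN k r y ry.
have /fin_all_exists[x rx] j : exists x, r 0 j = proj w x by apply: proj_surj.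
have /fin_all_exists[z yz] j : exists z, (y j : B) = proj p%:R z.
  exact: proj_surj.
have [j xj] : exists j, x j \is a GRing.unit.
  apply/existsP; rewrite -[X in is_true X]negbK negb_exists; apply/negP.
  move=> /forallP xN.
  have /proj_eqP[t] : proj p%:R (\sum_j x j ^+ p * z j) = proj p%:R 1.
    rewrite rmorph_sum rmorph1 -[RHS]ry; apply: eq_bigr => j _.
    by rewrite rmorphM /= -frobenius_proj -rx -yz.
  move/eqP; rewrite subr_eq addrC -subr_eq => /eqP one_in.
  suff: (1 : V) \in @maximal_ideal V by rewrite unfold_in unitr1.
  rewrite -one_in; apply: rpredB.
    apply: rpred_sum => j _; rewrite unfold_in unitrM negb_and.
    by rewrite unitrX_pos ?prime_gt0 // xN.
  by rewrite unfold_in unitrM negb_and pN orbT.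
exists (\col_i if i == j then proj w (x j)^-1 else 0).
rewrite [LHS]mx11_scalar mxE (bigD1 j) //= mxE eqxx rx -rmorphM mulrV //.
by rewrite rmorph1 big1 ?addr0 // => i /negbTE ij; rewrite mxE ij mulr0.
Qed.

End Frobenius.

Lemma mixed_characteristic_nonunit (p : nat) (V : valuationDomainType) :
  mixed_characteristic V p -> (p%:R : V) \isn't a GRing.unit.
Proof.
case=> _ /andP[_] /eqP p0.
pose res := \pi_({ideal_quot (@maximal_ideal V)})%qT : V -> _.
have : res p%:R == res 0.
  by apply/eqP; rewrite /res rmorph_nat rmorph0; exact: p0.
by rewrite -Quotient.idealrBE subr0.
Qed.

Lemma mixed_characteristic_neq0 (p : nat) (V : valuationDomainType) :
  prime p -> mixed_characteristic V p -> p%:R != 0 :> V.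
Proof.
move=> p_prime [char0 _]; apply/eqP => p0.
have := char0 p; rewrite !inE p_prime -(rmorph_nat (@tofrac V)) p0 rmorph0.
by rewrite eqxx.
Qed.

Theorem proposition5p1 (p : nat) (p_prime : prime p)
    (V : valuationDomainType) (charV : mixed_characteristic V p)
    (w u : V) (u_unit : u \is a GRing.unit) (wpE : w ^+ p = p%:R * u) :
  exists phi : {rmorphism principal_quot w -> principal_quot (p%:R : V)},
    (forall x : V, phi (proj w x) = proj (p%:R : V) (x ^+ p))
    /\ faithfully_flat_morphism phi.
Proof.
have pN := mixed_characteristic_nonunit charV.
have p_neq0 := mixed_characteristic_neq0 p_prime charV.
exists (frobenius_rmorphism p_prime wpE); split.
  exact: (frobenius_proj p_prime wpE).
apply: (equationally_flat_faithful _ (frobenius_unimodular pN)).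
apply: equationally_flat_torsion; first exact: quot_dvd_total.
exact: (frobenius_torsion u_unit p_neq0).
Qed.
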